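(* Let $d,k\ge 2$. There are no $2$-outlier-regular $(d,k;+1)$-digraphs; that is, there is no $(d,k;+1)$-digraph whose outlier function $o$ is a permutation of the vertex set all of whose cycles are transpositions.
   Context: Digraphs are finite and without multiple arcs. A digraph $G$ is $k$-geodetic if for any (not necessarily distinct) vertices $u,v$ there is at most one directed walk from $u$ to $v$ of length at most $k$ (walks of length $0$ count, so there are no directed cycles of length at most $k$). Put $M(d,k)=1+d+d^2+\dots+d^k$. A $(d,k;+1)$-digraph is a $k$-geodetic digraph with minimum out-degree $d$ and order $M(d,k)+1$. In such a digraph, for every vertex $u$ there is a unique vertex $o(u)$ with $d(u,o(u))\ge k+1$ (where $d(\cdot,\cdot)$ is directed distance, possibly infinite); $o:V(G)\to V(G)$ is the outlier function. It is known that $o$ is an automorphism of $G$. The digraph is $\omega$-outlier-regular if every cycle of the permutation $o$ has length exactly $\omega$. *)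

(* Defs.v *)
From mathcomp Require Import all_boot all_fingroup.

Set Implicit Arguments.
Unset Strict Implicit.
Unset Printing Implicit Defensive.

Section Digraphs.

(* A finite digraph without multiple arcs is a relation on a finite type. *)
Variables (V : finType) (e : rel V).

(* The walk with vertices u :: p, whose length is size p. *)
Definition walk (u v : V) (p : seq V) : bool := path e u p && (last u p == v).

Definition geodetic (k : nat) : Prop :=
  forall (u v : V) (p q : seq V),
    walk u v p -> size p <= k -> walk u v q -> size q <= k -> p = q.

Definition outdeg (u : V) : nat := #|[set v | e u v]|.

Definition min_outdeg (d : nat) : Prop :=
  (forall u, d <= outdeg u) /\ (exists u, outdeg u = d).

(* None stands for infinity. Bounding the length by #|V| loses nothing, since
   a shortest walk repeats no vertex. *)
Definition distance (u v : V) : option nat :=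
  ohead [seq n <- iota 0 #|V| | [exists p : n.-tuple V, walk u v p]].

Definition distance_geq (m : nat) (u v : V) : bool :=
  if distance u v is Some n then m <= n else true.

(* The default value u is irrelevant: in a (d,k;+1)-digraph with d, k >= 2
   exactly one vertex is at distance at least k + 1 from u. *)
Definition outlier (k : nat) (u : V) : V :=
  odflt u [pick v | distance_geq k.+1 u v].

Definition outlier_regular (k w : nat) : Prop :=
  exists2 o : {perm V}, o =1 outlier k &
    forall C : {set V}, C \in porbits o -> #|C| = w.

Definition Moore_bound (d k : nat) : nat := \sum_(i < k.+1) d ^ i.

(* (d,k;+1)-digraphs *)
Definition excess_one_digraph (d k : nat) : Prop :=
  [/\ geodetic k, min_outdeg d & #|V| = Moore_bound d k + 1].

End Digraphs.

(* Main.v *)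
(** Let [A] be the adjacency matrix and [P] the permutation matrix of the
    outlier function. Counting walks gives [1 + A + ... + A^k = J - P]. If [P]
    is a fixed-point-free involution, then [A^k] and [P A^k] have zero trace,
    because no vertex [u] has a walk of length [k] to itself or to [o(u)].
    Multiplied by [1 - P] the relation becomes [(1 - P) (A + ... + A^k) = 0],
    so [(1 - P) A^k] is twice an idempotent; having zero trace it vanishes,
    and with it [(1 - P) A]. Hence [P A = A], and [A P = A] by transposition: for [u -> v]
    and [v -> w] there is a second walk from [u] to [w], through [o(v)]. *)
Require Import Defs.
From mathcomp Require Import all_boot all_fingroup all_algebra.

Set Implicit Arguments.
Unset Strict Implicit.
Unset Printing Implicit Defensive.

Import GRing.Theory Num.Theory.
Local Open Scope ring_scope.

(** * Matrix consequences of [1 + A + ... + A^k = J - P] *)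

Lemma mxtrace_quasi_idempotent (F : fieldType) (n : nat) (c : F) (E : 'M[F]_n) :
  E *m E = c *: E -> \tr E = c * (\rank E)%:R.
Proof.
(* [E] is [col_base E *m row_base E]; cancelling both full-rank factors in [E *m E = c *: E] shows
   that the reversed product, of size [\rank E], is the scalar [c]. *)
move=> EE; have RC : row_base E *m col_base E = c%:M.
  apply: (row_full_inj (col_base_full E)).
  apply: (row_free_inj (row_base_free E)).
  rewrite mulmxA mulmx_base -mulmxA mulmx_base EE.
  by rewrite mul_mx_scalar -scalemxAl mulmx_base.
by rewrite -{1}(mulmx_base E) mxtrace_mulC RC mxtrace_scalar mulr_natr.
Qed.

(* With [R := 1 - P], the relation gives [R A^(k+1) = R A]; that [A] commutes
   with [J - P] gives [R A J = 0], hence [R A R = 2 R A]. *)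
Lemma absorbing_involution_relations (S : pzRingType) (n k : nat) (A P J : S) :
    (forall m (x : S), x *+ m.+1 = 0 -> x = 0) ->
    (2 < n)%N -> (0 < k)%N ->
    P * P = 1 -> P * J = J -> J * J = J *+ n ->
    \sum_(i < k.+1) A ^+ i = J - P ->
  let E := (1 - P) * A ^+ k in
  E * E = E *+ 2 /\ (1 - P) * A = E * A.
Proof.
move=> tf n2 k0 PP PJ JJ sumA.
rewrite /=; have [R defR] : {R | R = 1 - P} by exists (1 - P).
rewrite -defR.
have RJ : R * J = 0 by rewrite defR mulrBl mul1r PJ subrr.
have RP : R * P = - R by rewrite defR mulrBl mul1r PP opprB.
have RS : R * (J - P) = R by rewrite mulrBr RJ RP sub0r opprK.
have AS : A * (J - P) = (J - P) * A.
  rewrite -sumA mulr_sumr mulr_suml; apply: eq_bigr => i _.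
  by rewrite -exprS -exprSr.
(* Multiply [A^(k+1) - 1 = (A - 1)(J - P)] on the left by [R], using [R (J - P) = R]. *)
have RAk : R * A = R * A ^+ k.+1.
  have := subrX1 A k.+1; rewrite sumA => /(congr1 ( *%R R)).
  rewrite mulrBl AS mul1r !mulrBr mulrA RS mulr1.
  by rewrite -mulrBr RS => /addIr.
have RAS : R * A * (J - P) = R * A by rewrite -mulrA AS mulrA RS.
(* Since [(J - P) J = (n - 1) J], evaluating [R A (J - P) J] in two ways gives [(n - 2) R A J = 0],
   where [n > 2]. *)
have RAJ : R * A * J = 0.
  have : R * A * (J - P) * J = R * A * J by rewrite RAS.
  rewrite -mulrA [(J - P) * J]mulrBl PJ JJ mulrBr mulrnAr => /eqP.
  rewrite subr_eq -mulr2n -subr_eq0 -mulrnBr; last exact: ltnW.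
  by case: n n2 {JJ} => [|[|[|n]]] // _ /eqP /tf.
have RAR : R * A * R = R * A *+ 2.
  rewrite {2}defR mulrBr mulr1 mulr2n; congr (_ + _).
  by rewrite -[RHS]RAS mulrBr RAJ sub0r.
have RAiR i : R * A ^+ i.+1 * R = R * A ^+ i.+1 *+ 2.
  elim: i => [|i IHi]; first by rewrite expr1.
  have E2 : R * A ^+ i.+2 *+ 2 = R * A ^+ i.+1 * R * A.
    by rewrite IHi mulrnAl exprSr mulrA.
  (* Doubling creates an inner [R]: [2 R A^(i+2) R = R A^(i+1) (R A R) = 2 R A^(i+1) R A = 4 R
     A^(i+2)]. *)
  apply/subr0_eq/(tf 1%N)/eqP; rewrite mulrnBl subr_eq0.
  rewrite -[X in X == _]mulrnAl E2.
  by rewrite -!mulrA (mulrA R A R) RAR !mulrnAr !mulrA.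
case: k k0 {sumA} RAk => // k _ RAk; split; last by rewrite -mulrA -exprSr.
(* Here [k] is the old exponent minus one, and [R A^(2k+2) = R A^(k+2) A^k = R A^(k+1)]. *)
rewrite !mulrA RAiR mulrnAl -mulrA -exprD addSn exprS; congr (_ *+ _).
rewrite addnS -addSn exprD !mulrA -(mulrA R A) -exprS.
by rewrite -RAk -mulrA -exprS.
Qed.

Lemma absorbing_involution_mx (n k : nat) (A P : 'M[rat]_n)
    (J := const_mx 1 : 'M[rat]_n) :
    (2 < n)%N -> (0 < k)%N ->
    P *m P = 1%:M -> P *m J = J ->
    \sum_(i < k.+1) A ^+ i = J - P ->
    \tr (A ^+ k) = 0 -> \tr (P *m A ^+ k) = 0 ->
  P *m A = A.
Proof.
move=> n2 k0 PP PJ sumA trA trPA.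
have JJ : J * J = J *+ n.
  apply/matrixP => i j; rewrite !mxE (eq_bigr (fun=> 1)) => [|l _].
    by rewrite sumr_const card_ord mulmxnE mxE.
  by rewrite !mxE mulr1.
have tf m (B : 'M[rat]_n) : B *+ m.+1 = 0 -> B = 0.
  move=> /matrixP B0; apply/matrixP => i j; have /eqP := B0 i j.
  by rewrite mulmxnE mxE mulrn_eq0 => /eqP.
have [EE RA] := absorbing_involution_relations tf n2 k0 PP PJ JJ sumA.
set E := (1 - P) * A ^+ k in EE RA.
have trE : \tr E = 0.
  by rewrite /E mulrBl mul1r raddfB /= trA trPA subrr.
have E0 : E = 0.
  have /mxtrace_quasi_idempotent : E *m E = 2 *: E by rewrite scaler_nat.
  by rewrite trE => /esym/eqP; rewrite mulf_eq0 !pnatr_eq0 /= mxrank_eq0 => /eqP.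
by apply/esym/subr0_eq; move: RA; rewrite E0 mul0r mulrBl mul1r.
Qed.

(** * Walk counts, geodecity and distance *)

Section WalkCounting.

Variables (V : finType) (e : rel V).

Definition nwalks (i : nat) (u v : V) : nat :=
  #|[pred p : i.-tuple V | walk e u v p]|.

Lemma nwalks0 u v : nwalks 0 u v = (u == v).
Proof.
rewrite /nwalks.
case: eqVneq => [->|/negPf neq_uv]; last first.
  by apply: eq_card0 => p; rewrite tuple0 !inE /walk /= neq_uv.
rewrite /= -(card1 ([tuple] : 0.-tuple V)); apply: eq_card => p.
by rewrite tuple0 !inE /walk /= !eqxx.
Qed.

Lemma nwalksS i u v :
  nwalks i.+1 u v = (\sum_w e u w * nwalks i w v)%N.
Proof.
rewrite /nwalks -sum1_card big_mkcond /=.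
rewrite (reindex (fun wp : V * i.-tuple V => [tuple of wp.1 :: wp.2])) /=; last first.
  exists (fun p => (thead p, [tuple of behead p])) => [[w p] _|p _].
    by congr pair; apply: val_inj.
  by rewrite -tuple_eta.
rewrite -(pair_bigA _ (fun w (p : i.-tuple V) => if walk e u v (w :: p) then 1 else 0)%N) /=.
apply: eq_bigr => w _; rewrite -sum1_card [in RHS]big_mkcond /=.
rewrite big_distrr /=; apply: eq_bigr => p _.
by rewrite /walk /= unfold_in /=; case: (e u w); rewrite ?mul1n ?mul0n.
Qed.

Lemma sum_nwalks_ge d i u :
  (forall w, d <= outdeg e w)%N -> (d ^ i <= \sum_v nwalks i u v)%N.
Proof.
move=> le_d; elim: i u => [|i IHi] u.
  rewrite (eq_bigr (fun v => nat_of_bool (u == v))) => [|v _]; last exact: nwalks0.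
  by rewrite (bigD1 u) //= eqxx.
rewrite (eq_bigr _ (fun v _ => nwalksS i u v)) exchange_big /=.
have /leq_trans : (d ^ i.+1 <= \sum_(w | e u w) d ^ i)%N.
  rewrite sum_nat_const expnS leq_mul2r; apply/orP; right.
  by have := le_d u; rewrite /outdeg cardsE.
apply; rewrite big_mkcond /=; apply: leq_sum => w _.
case: (e u w) => //; apply: leq_trans (IHi w) _.
by under [X in (_ <= X)%N]eq_bigr do rewrite mul1n.
Qed.

Lemma geodetic_sum_nwalks k u v :
  geodetic e k -> (\sum_(i < k.+1) nwalks i u v <= 1)%N.
Proof.
move=> geo; under eq_bigr do rewrite /nwalks -sum1_card.
(* The sum is the number of pairs of a length and a walk; geodecity identifies the walks as
   sequences, hence also their lengths. *)
rewrite sig_big_dep /= sum1_card; apply/card_le1_eqP => -[i p] [j q].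
rewrite !unfold_in /= => up uq.
have pq : p = q :> seq V by apply: (geo u v); rewrite ?size_tuple // -ltnS.
have ij : i = j by apply: val_inj; rewrite /= -(size_tuple p) pq size_tuple.
by case: j / ij q uq pq => q _ /val_inj ->.
Qed.

(** The distance heads an increasing list of walk lengths below [#|V|]; as [k < #|V|], a walk of
    length [i <= k] would be listed and force the head to be at most [i]. *)
Lemma nwalks_far k i u v :
  (k < #|V|)%N -> (i <= k)%N -> distance_geq e k.+1 u v -> nwalks i u v = 0%N.
Proof.
move=> kV ik; rewrite /distance_geq /distance.
set a := fun n => [exists p : n.-tuple V, walk e u v p].
move=> far; apply/eqP; rewrite -leqn0 leqNgt; apply/card_gt0P => -[p]; rewrite inE => up.
have : i \in [seq n <- iota 0 #|V| | a n].
  rewrite mem_filter mem_iota (leq_ltn_trans ik kV) /= andbT.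
  by apply/existsP; exists p.
have : sorted ltn [seq n <- iota 0 #|V| | a n].
  by apply: sorted_filter; [exact: ltn_trans | exact: iota_ltn_sorted].
move: far; case: (filter _ _) => //= m s km.
rewrite inE (path_sortedE ltn_trans) => /andP [/allP ms _] /orP [/eqP im|/ms].
  by rewrite -im ltnNge ik in km.
by move=> /(ltn_trans km); rewrite ltnNge (leq_trans ik).
Qed.

End WalkCounting.

(** * Matrices indexed by vertices *)

Section FunctionMatrix.

Variable V : finType.

(** Transport along [enum_val] turns products and traces into sums over [V]. *)
Definition fun_mx (f : V -> V -> rat) : 'M[rat]_#|V| :=
  \matrix_(i, j) f (enum_val i) (enum_val j).

Lemma fun_mxE f u v : fun_mx f (enum_rank u) (enum_rank v) = f u v.
Proof. by rewrite mxE !enum_rankK. Qed.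

Lemma eq_fun_mx f g : f =2 g -> fun_mx f = fun_mx g.
Proof. by move=> fg; apply/matrixP => i j; rewrite !mxE. Qed.

Lemma sum_enum_val (F : V -> rat) : \sum_(i < #|V|) F (enum_val i) = \sum_v F v.
Proof. by rewrite -(big_enum_val F). Qed.

Lemma mul_fun_mx f g :
  fun_mx f *m fun_mx g = fun_mx (fun u v => \sum_w f u w * g w v).
Proof.
apply/matrixP => i j; rewrite !mxE -sum_enum_val.
by apply: eq_bigr => l _; rewrite !mxE.
Qed.

Lemma mxtrace_fun_mx f : \tr (fun_mx f) = \sum_v f v v.
Proof. by rewrite -sum_enum_val; apply: eq_bigr => i _; rewrite mxE. Qed.

Lemma fun_mx_nwalks (e : rel V) i :
  fun_mx (fun u v => (e u v)%:R) ^+ i = fun_mx (fun u v => (nwalks e i u v)%:R).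
Proof.
elim: i => [|i IHi].
  apply/matrixP => a b; rewrite !mxE nwalks0 (inj_eq enum_val_inj).
  by case: eqP.
rewrite exprS IHi [LHS]mul_fun_mx; apply: eq_fun_mx => u v.
rewrite nwalksS natr_sum; apply: eq_bigr => w _.
by rewrite natrM.
Qed.

End FunctionMatrix.

Lemma trmxX (R : comPzRingType) (n i : nat) (A : 'M[R]_n) : (A ^+ i)^T = A^T ^+ i.
Proof.
elim: i => [|i IHi]; first exact: trmx1.
by rewrite exprS exprSr [LHS]trmx_mul IHi.
Qed.

Lemma involutive_outlier_absorbs (V : finType) (e : rel V) (k : nat) (o : V -> V) :
    (2 < #|V|)%N -> (0 < k)%N -> (forall u, o u != u) -> involutive o ->
    (forall u v, \sum_(i < k.+1) nwalks e i u v = (o u != v))%N ->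
  forall u v, e (o u) v = e u v /\ e u (o v) = e u v.
Proof.
move=> V2 k0 ofree oK count.
pose A := fun_mx (fun u v => (e u v)%:R).
pose P := fun_mx (fun u v : V => (o u == v)%:R).
pose J := const_mx 1 : 'M[rat]_#|V|.
have Pl f : P *m fun_mx f = fun_mx (fun u v => f (o u) v).
  rewrite mul_fun_mx; apply: eq_fun_mx => u v; rewrite (bigD1 (o u)) //=.
  rewrite eqxx mul1r big1 ?addr0 // => w /negPf; rewrite eq_sym => ->.
  by rewrite mul0r.
have trP : P^T = P.
  apply/matrixP => i j; rewrite !mxE; congr (_ %:R); congr nat_of_bool.
  by apply/eqP/eqP => <-; rewrite oK.
have defJ : J = fun_mx (fun _ _ => 1) by apply/matrixP => i j; rewrite !mxE.
have PP : P *m P = 1%:M.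
  rewrite Pl; apply/matrixP => i j.
  by rewrite !mxE oK (inj_eq enum_val_inj).
have PJ : P *m J = J by rewrite defJ Pl.
have sumA : \sum_(i < k.+1) A ^+ i = J - P.
  apply/matrixP => i j; rewrite summxE !mxE.
  under eq_bigr do rewrite fun_mx_nwalks mxE.
  rewrite -natr_sum count; case: (_ == _) => /=; by rewrite ?subrr ?subr0.
have trA : \tr (A ^+ k) = 0.
  rewrite fun_mx_nwalks mxtrace_fun_mx big1 // => u _.
  (* The total count from [u] to [u] is 1, and the walk of length 0 exhausts it. *)
  have := count u u; rewrite ofree big_ord_recl nwalks0 eqxx => -[].
  case: k k0 {sumA count} => // k _ /eqP.
  by rewrite add0n big_ord_recr addn_eq0 => /andP [_ /eqP ->].
have trPA : \tr (P *m A ^+ k) = 0.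
  rewrite fun_mx_nwalks Pl mxtrace_fun_mx big1 // => u _.
  (* As [u] is the outlier of [o u], no walk of length at most [k] joins [o u] to [u]. *)
  have /eqP := count (o u) u; rewrite oK eqxx big_ord_recr /= addn_eq0.
  by move=> /andP [_ /eqP ->].
have PA : P *m A = A := absorbing_involution_mx V2 k0 PP PJ sumA trA trPA.
have AP : A *m P = A.
  (* [P] and [J] are symmetric, so [A^T] satisfies the hypotheses imposed on [A]. *)
  apply: trmx_inj; rewrite trmx_mul trP.
  apply: (absorbing_involution_mx V2 k0 PP PJ).
  - have := congr1 trmx sumA; rewrite raddf_sum raddfB /= trP trmx_const => <-.
    by apply: eq_bigr => i _; rewrite trmxX.
  - by rewrite -trmxX mxtrace_tr.
  - by rewrite -trmxX -mxtrace_tr trmx_mul trmxK trP mxtrace_mulC.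
have nat_bool_inj (b c : bool) : b%:R = c%:R :> rat -> b = c.
  by case: b c => -[].
move=> u v; split; apply: nat_bool_inj.
  by rewrite -[RHS](fun_mxE (fun u v => (e u v)%:R)) -/A -PA Pl fun_mxE.
rewrite -[RHS](fun_mxE (fun u v => (e u v)%:R)) -/A -AP mul_fun_mx fun_mxE.
rewrite (bigD1 (o v)) //= oK eqxx mulr1 big1 ?addr0 // => w.
by rewrite -(inj_eq (can_inj oK)) oK => /negPf ->; rewrite mulr0.
Qed.

(* Outliers and the contradiction *)
Local Close Scope ring_scope.

Lemma outlier_regular2 (V : finType) (e : rel V) (k : nat) :
    outlier_regular e k 2 ->
  let o := outlier e k in
  [/\ involutive o, forall u, o u != u & forall u, distance_geq e k.+1 u (o u)].
Proof.
case=> o oE card2 /=.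
have oC u : #|porbit o u| = 2 by apply: card2; apply: imset_f.
have ofree u : o u != u.
  apply/eqP => ou; have := oC u; suff -> : porbit o u = [set u] by rewrite cards1.
  apply/setP => v; rewrite inE; apply/porbitP/eqP => [[i ->]|->]; last first.
    by exists 0%N; rewrite expg0 perm1.
  by rewrite permX; elim: i => //= i ->.
split=> [u|u|u]; rewrite -!oE //; first by have := iter_porbit o u; rewrite oC.
(* A failed [pick] would return the default [u], which is not moved. *)
have := ofree u; rewrite oE /outlier.
by case: pickP => //= _; rewrite eqxx.
Qed.

(** At least [M(d,k)] walks of length at most [k] leave [u]; none ends at [o u], and at most one at
    each of the other [M(d,k)] vertices. Equality of the totals forces exactly one at each. *)
Lemma sum_nwalks_outlier (V : finType) (e : rel V) (d k : nat) (o : V -> V) :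
    excess_one_digraph e d k -> 0 < d ->
    (forall u, distance_geq e k.+1 u (o u)) ->
  forall u v, \sum_(i < k.+1) nwalks e i u v = (o u != v) :> nat.
Proof.
case=> geo [le_d _] cardV d0 far u.
have kV : k < #|V|.
  rewrite cardV addn1 ltnS -[leqLHS]/(k.+1.-1) -{1}(card_ord k.+1) -sum1_card.
  apply: leq_trans (leq_pred _) _; apply: leq_sum => i _.
  by rewrite expn_gt0 d0.
have sum0 : \sum_(i < k.+1) nwalks e i u (o u) = 0.
  by rewrite big1 // => i _; apply: (nwalks_far kV) => //; rewrite -ltnS.
have sum_all : \sum_v \sum_(i < k.+1) nwalks e i u v =
    \sum_(v | v != o u) \sum_(i < k.+1) nwalks e i u v.
  by rewrite (bigD1 (o u)) //= sum0.
have leif1 v : v != o u ->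
    \sum_(i < k.+1) nwalks e i u v <= 1 ?= iff (\sum_(i < k.+1) nwalks e i u v == 1).
  by move=> _; split; [exact: geodetic_sum_nwalks | ].
have [_ eq1] := leqif_sum leif1.
have card1 : \sum_(v | v != o u) 1 = Moore_bound d k.
  rewrite sum1_card; apply/eqP; rewrite -(eqn_add2r 1) -cardV addn1.
  by rewrite (cardC1 (o u)) prednK // (leq_ltn_trans _ kV).
have [le1 _] := leqif_sum leif1.
have : \sum_(v | v != o u) \sum_(i < k.+1) nwalks e i u v == \sum_(v | v != o u) 1.
  rewrite eqn_leq le1 card1 -sum_all exchange_big /=.
  by apply: leq_sum => i _; apply: sum_nwalks_ge.
rewrite eq1 => /forallP all1 v.
case: eqVneq => [<- //|ouv]; apply/eqP.
by have := all1 v; rewrite eq_sym ouv.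
Qed.

Theorem theorem5 (d k : nat) (hd : 2 <= d) (hk : 2 <= k)
    (V : finType) (e : rel V) (he : excess_one_digraph e d k) :
  ~ outlier_regular e k 2.
Proof.
case/outlier_regular2 => oK ofree far.
have count := sum_nwalks_outlier he (ltnW hd) far.
case: he => geo [le_d [u _]] cardV.
have V2 : 2 < #|V|.
  rewrite cardV addn1 ltnS /Moore_bound.
  case: k hk {geo oK ofree far count cardV} => [//|k _].
  rewrite !big_ord_recl expn0 add1n ltnS; apply: leq_trans (leq_addr _ _).
  by rewrite expn_gt0 ltnW.
have twin := involutive_outlier_absorbs V2 (ltnW hk) ofree oK count.
have nbr x : exists y, e x y.
  have /card_gt0P [y] : 0 < outdeg e x by apply: leq_trans (le_d x); exact: ltnW.
  by rewrite inE; exists y.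
have [v uv] := nbr u; have [w vw] := nbr v.
have w1 : walk e u w [:: v; w] by rewrite /walk /= uv vw eqxx.
have w2 : walk e u w [:: outlier e k v; w].
  by rewrite /walk /= (twin u v).2 (twin v w).1 uv vw eqxx.
(* Both walks have length 2, at most [k], so geodecity would give [o(v) = v]. *)
have [/esym/eqP] := geo u w _ _ w1 hk w2 hk.
by apply/negP/ofree.
Qed.
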